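(* Let $n \geq 2$ be even and let $m$ be a prime with $m \equiv -1 \pmod n$. Then $\mathbb{Z}_m^n$ is $H$-closed. Namely, if $\mathbf{u} \in K(\mathbb{Z}_m^n)$, then $D^{m-1}(\mathbf{u})=H^{-1}(\mathbf{u})$.
   Context: The Ducci function is the endomorphism $D$ of $\mathbb{Z}_m^n$ given by $D(x_1,\dots,x_n)=(x_1+x_2 \bmod m, x_2+x_3 \bmod m,\dots,x_n+x_1 \bmod m)$, and $H$ is the endomorphism $H(x_1,\dots,x_n)=(x_2,x_3,\dots,x_n,x_1)$; $H^{-1}$ is its inverse, $H^{-1}(x_1,\dots,x_n)=(x_n,x_1,\dots,x_{n-1})$. The Ducci sequence of $\mathbf{u}$ is $\{D^{\alpha}(\mathbf{u})\}_{\alpha \geq 0}$. The Ducci cycle of $\mathbf{u}$ is the set of $\mathbf{v}$ for which there exist integers $\alpha \geq 0$, $\beta \geq 1$ with $\mathbf{v}=D^{\alpha+\beta}(\mathbf{u})=D^{\alpha}(\mathbf{u})$. $K(\mathbb{Z}_m^n)$ is the set of all tuples in $\mathbb{Z}_m^n$ that belong to the Ducci cycle of some $\mathbf{u} \in \mathbb{Z}_m^n$. The Ducci sequence of $\mathbf{u}$ is called $H$-closed if for every $\mathbf{v}$ in the Ducci cycle of $\mathbf{u}$ and every $-n<\beta<n$, $H^{\beta}(\mathbf{v})$ also belongs to the Ducci cycle of $\mathbf{u}$; $\mathbb{Z}_m^n$ is called $H$-closed if the Ducci sequence of every $\mathbf{u} \in \mathbb{Z}_m^n$ is $H$-closed.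 *)

(* Defs.v *)
From HB Require Import structures.
From mathcomp Require Import all_boot all_order all_algebra.

Set Implicit Arguments.
Unset Strict Implicit.
Unset Printing Implicit Defensive.

Import Order.TTheory GRing.Theory Num.Theory.
Local Open Scope ring_scope.

(* The tuple (x_1, ..., x_n) is the row vector with entries x 0 i, i : 'I_n,
   so that x_(i+1) is x 0 i.  The cyclic successor and predecessor of an index
   are ordS and ord_pred.  Everything below is meaningful only for 1 < m, since
   'Z_0 and 'Z_1 are both the integers mod 2. *)
Definition Zmn (m n : nat) := 'rV['Z_m]_n.

Section Ducci.

Variables m n : nat.
Implicit Types u v x : Zmn m n.

Definition ducciD x : Zmn m n := \row_i (x 0 i + x 0 (ordS i)).

Definition shiftH x : Zmn m n := \row_i x 0 (ordS i).

Definition shiftHinv x : Zmn m n := \row_i x 0 (ord_pred i).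

Lemma shiftHK : cancel shiftH shiftHinv.
Proof. by move=> x; apply/rowP => i; rewrite !mxE ord_predK. Qed.

Lemma shiftHinvK : cancel shiftHinv shiftH.
Proof. by move=> x; apply/rowP => i; rewrite !mxE ordSK. Qed.

(* Negz k stands for the integer - k.+1. *)
Definition shiftHz (b : int) x : Zmn m n :=
  match b with
  | Posz k => iter k shiftH x
  | Negz k => iter k.+1 shiftHinv x
  end.

Definition ducci_cycle u v : Prop :=
  exists a b : nat, [/\ (1 <= b)%N, v = iter (a + b) ducciD u
                      & iter (a + b) ducciD u = iter a ducciD u].

Definition ducciK v : Prop := exists u, ducci_cycle u v.

Definition seq_H_closed u : Prop :=
  forall v, ducci_cycle u v ->
  forall b : int, - n%:Z < b -> b < n%:Z -> ducci_cycle u (shiftHz b v).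

Definition H_closed : Prop := forall u, seq_H_closed u.

End Ducci.

(* Main.v *)
(* Write D = 1 + H. In characteristic m, D^m = 1 + H^m, and H^m = H^-1 because
   H^n = 1 and n divides m + 1; hence D^m = 1 + H^-1 = H^-1 D.  An element of a
   cycle lies in the image of D, so one factor D can be cancelled there. *)
Require Import Defs.
From mathcomp Require Import all_boot all_order all_algebra.

Import Order.TTheory GRing.Theory Num.Theory.
Local Open Scope ring_scope.

Lemma val_iter_ordS n k (i : 'I_n) : iter k (@ordS n) i = ((i + k) %% n)%N :> nat.
Proof.
elim: k => [|k IHk] /=; first by rewrite addn0 modn_small.
by rewrite IHk -addn1 modnDml addn1 addnS.
Qed.

Lemma iter_shiftHE m n k (x : Zmn m n) i :
  iter k (@shiftH m n) x 0 i = x 0 (iter k (@ordS n) i).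
Proof. by elim: k x i => // k IHk x i; rewrite iterSr IHk mxE. Qed.

Lemma iter_shiftH_dvd m n k (x : Zmn m n) :
  (n %| k)%N -> iter k (@shiftH m n) x = x.
Proof.
case/dvdnP=> q ->; apply/rowP=> i; rewrite iter_shiftHE; congr (x 0 _).
by apply: val_inj; rewrite /= val_iter_ordS addnC modnMDl modn_small.
Qed.

Lemma iter_shiftH_pred m n k (x : Zmn m n) :
  (n %| k.+1)%N -> iter k (@shiftH m n) x = shiftHinv x.
Proof. by move=> nk; rewrite -[LHS]shiftHK -iterS iter_shiftH_dvd. Qed.

Lemma iter_can (T : Type) (f g : T -> T) k :
  cancel f g -> cancel (iter k f) (iter k g).
Proof. by move=> fK; elim: k => // k IHk x; rewrite iterSr /= fK IHk. Qed.

(** Since [k.+1] shifts act trivially, [x] is [H^k (H x)], and the [k] inverse shifts cancel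
    [H^k]. *)
Lemma iter_shiftHinv_pred m n k (x : Zmn m n) :
  (n %| k.+1)%N -> iter k (@shiftHinv m n) x = shiftH x.
Proof.
move=> nk; rewrite -{1}(iter_shiftH_dvd m n _ x nk) iterSr.
exact: iter_can (@shiftHK m n) _.
Qed.

(** Encoding H as a matrix turns iterates into powers in a ring, where Frobenius applies. *)
Definition shift_mx m n : 'M['Z_m]_n := \matrix_(i, j) (i == ordS j)%:R.

Lemma mul_shift_mx m n (x : Zmn m n) : x *m shift_mx m n = shiftH x.
Proof.
apply/rowP=> j; rewrite !mxE (bigD1 (ordS j)) //= !mxE eqxx mulr1 big1 ?addr0 //.
by move=> i /negPf ij; rewrite mxE ij mulr0.
Qed.

Lemma iter_mulmxr (R : nzRingType) n k (A : 'M[R]_n.+1) (f : 'rV_n.+1 -> 'rV_n.+1) x :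
  (forall y, f y = y *m A) -> iter k f x = x *m A ^+ k.
Proof.
move=> fE; elim: k => [|k IHk] /=; first by rewrite mulmx1.
by rewrite IHk fE exprSr mulmxA.
Qed.

Lemma iter_ducciD_prime m n (x : Zmn m n) :
  prime m -> iter m (@ducciD m n) x = x + iter m (@shiftH m n) x.
Proof.
(* Square matrices form a nonzero ring only in positive size. *)
case: n x => [|n] x m_prime; first by apply/rowP=> -[].
have pcharM : m \in [pchar 'M['Z_m]_n.+1].
  rewrite inE m_prime -scaler_nat pchar_Zp ?prime_gt1 //=.
  by rewrite scale0r.
rewrite (@iter_mulmxr _ _ _ (1 + shift_mx m n.+1)); last first.
  by move=> y; rewrite mulmxDr mulmx1 mul_shift_mx; apply/rowP=> i; rewrite !mxE.
rewrite (@iter_mulmxr _ _ _ (shift_mx m n.+1)) => [|y]; last by rewrite mul_shift_mx.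
(* The matrix ring is not commutative, but 1 commutes with the shift, so the m-th power is additive
   on their sum. *)
have := pFrobenius_autD_comm pcharM (commr_sym (commr1 (shift_mx m n.+1))).
rewrite !pFrobenius_autE expr1n => ->.
by rewrite mulmxDr mulmx1.
Qed.

(** Applying D [k] more times delays the start to [k + a] and keeps the period [b]. *)
Lemma ducci_cycle_iter m n k (u v : Zmn m n) :
  ducci_cycle u v -> ducci_cycle u (iter k (@ducciD m n) v).
Proof.
case=> a [b [b_gt0 -> uab]]; exists (k + a)%N, b.
by rewrite -addnA [iter (k + (a + b)) _ _]iterD [iter (k + a) _ _]iterD uab.
Qed.

Lemma ducciK_image m n (v : Zmn m n) : ducciK v -> exists w, v = ducciD w.
Proof.
case=> u [a [[|b] [// _ -> _]]].
by exists (iter (a + b) (@ducciD m n) u); rewrite addnS.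
Qed.

Theorem theorem2 (n m : nat) (n_ge2 : (2 <= n)%N) (n_even : ~~ odd n)
    (m_prime : prime m) (m_modn : (m%:Z = -1 %[mod n%:Z])%Z) :
  H_closed m n /\
  (forall u : Zmn m n, ducciK u -> iter (m - 1)%N (@ducciD m n) u = shiftHinv u).
Proof.
have n_dvd : (n %| m.+1)%N.
  (* The congruence says that n divides m - (-1). *)
  by move/eqP: m_modn; rewrite eqz_mod_dvd opprK -PoszD addn1.
have m_gt0 := prime_gt0 m_prime.
have DHinv (u : Zmn m n) : ducciK u -> iter (m - 1) (@ducciD m n) u = shiftHinv u.
  (* With u = D w, the left side is D^m w = w + H^-1 w, which is H^-1 (D w). *)
  case/ducciK_image=> w ->; rewrite -iterSr subn1 prednK //.
  rewrite iter_ducciD_prime // iter_shiftH_pred //.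
  by apply/rowP=> i; rewrite !mxE ord_predK addrC.
split=> // u v uv b _ _.
(* On the cycle H^-1 is a power of D, and D preserves the cycle. *)
have cycleHinv w : ducci_cycle u w -> ducci_cycle u (shiftHinv w).
  by move=> uw; rewrite -DHinv; [apply: ducci_cycle_iter | exists u].
have cycleHinvn k w : ducci_cycle u w -> ducci_cycle u (iter k (@shiftHinv m n) w).
  by move=> uw; elim: k => //= k; apply: cycleHinv.
(* Forward shifts reduce to backward ones: H is the m-th iterate of H^-1. *)
have cycleH w : ducci_cycle u w -> ducci_cycle u (shiftH w).
  move=> uw; rewrite -(iter_shiftHinv_pred m n m) //; exact: cycleHinvn.
case: b => k; last exact: cycleHinvn.
by elim: k => //= k; apply: cycleH.
Qed.
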